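(* Let $n\in\{2,3\}$ and let $f\in C^{2n}[-1,1]$ be a real-valued function that is $(2n-1)$-convex on $[-1,1]$. Then \[ 0\le\int_{-1}^1 f(t)\,dt-\mathcal{G}_n[f]\le \mathcal{L}_{n+1}[f]-\int_{-1}^1 f(t)\,dt, \] where $\mathcal{G}_n$ is the $n$-point Gauss--Legendre quadrature and $\mathcal{L}_{n+1}$ is the $(n+1)$-point Lobatto quadrature on $[-1,1]$.
   Context: Divided differences of a function $f\colon I\to\mathbb{R}$ on a real interval $I$ at distinct points are defined recursively by $[x_1;f]=f(x_1)$ and \[ [x_1,\dots,x_{m+1};f]=\frac{[x_2,\dots,x_{m+1};f]-[x_1,\dots,x_m;f]}{x_{m+1}-x_1}. \] A function $f\colon I\to\mathbb{R}$ is called $m$-convex (Popoviciu's convention, in which $1$-convexity is ordinary convexity) if $[x_1,\dots,x_{m+2};f]\ge 0$ for all distinct $x_1,\dots,x_{m+2}\in I$. The quadratures, defined for $f\colon[-1,1]\to\mathbb{R}$, are: \[ \mathcal{G}_2[f]=f\bigl(-\tfrac{\sqrt3}{3}\bigr)+f\bigl(\tfrac{\sqrt3}{3}\bigr), \] \[ \mathcal{G}_3[f]=\tfrac59 f\bigl(-\tfrac{\sqrt{15}}{5}\bigr)+\tfrac89 f(0)+\tfrac59 f\bigl(\tfrac{\sqrt{15}}{5}\bigr), \] \[ \mathcal{L}_3[f]=\tfrac13 f(-1)+\tfrac43 f(0)+\tfrac13 f(1), \] \[ \mathcal{L}_4[f]=\tfrac16 f(-1)+\tfrac56 f\bigl(-\tfrac{\sqrt5}{5}\bigr)+\tfrac56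 f\bigl(\tfrac{\sqrt5}{5}\bigr)+\tfrac16 f(1). \] $C^{2n}[-1,1]$ denotes the $2n$-times continuously differentiable real functions on $[-1,1]$ (one-sided derivatives at the endpoints). *)

(* Defs.v *)
From Stdlib Require Import Reals.
From Coquelicot Require Import Coquelicot.
Open Scope R_scope.

(* A function on a subset [D] of the line is a total function [R -> R] of which
   only the values on [D] are ever constrained. *)

Definition I11 (x : R) : Prop := -1 <= x <= 1.

(* [divdiff f m x] is [x 0, ..., x m; f], on m+1 points. *)
Fixpoint divdiff (f : R -> R) (m : nat) (x : nat -> R) : R :=
  match m with
  | O => f (x O)
  | S k => (divdiff f k (fun i => x (S i)) - divdiff f k x) / (x (S k) - x O)
  end.

(* Popoviciu's convention: m-convexity involves m+2 points, here
   x 0, ..., x (m+1), so that 1-convexity is ordinary convexity. *)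
Definition m_convex_on (m : nat) (D : R -> Prop) (f : R -> R) : Prop :=
  forall x : nat -> R,
    (forall i, (i <= S m)%nat -> D (x i)) ->
    (forall i j, (i <= S m)%nat -> (j <= S m)%nat -> i <> j -> x i <> x j) ->
    0 <= divdiff f (S m) x.

(* [D_in] and [continue_in] take limits along points of [D] only, hence are
   one-sided at the endpoints when [D] is a closed interval. *)
Fixpoint Ck_on (k : nat) (D : R -> Prop) (f : R -> R) : Prop :=
  match k with
  | O => forall x, D x -> continue_in f D x
  | S j => exists f' : R -> R,
      (forall x, D x -> D_in f f' D x) /\ Ck_on j D f'
  end.

Definition gauss2 (f : R -> R) : R :=
  f (- (sqrt 3 / 3)) + f (sqrt 3 / 3).

Definition gauss3 (f : R -> R) : R :=
  5 / 9 * f (- (sqrt 15 / 5)) + 8 / 9 * f 0 + 5 / 9 * f (sqrt 15 / 5).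

Definition lobatto3 (f : R -> R) : R :=
  1 / 3 * f (-1) + 4 / 3 * f 0 + 1 / 3 * f 1.

Definition lobatto4 (f : R -> R) : R :=
  1 / 6 * f (-1) + 5 / 6 * f (- (sqrt 5 / 5)) + 5 / 6 * f (sqrt 5 / 5)
  + 1 / 6 * f 1.

(* The index is the number of nodes; only [gauss 2], [gauss 3], [lobatto 3] and
   [lobatto 4] are meaningful, the value 0 elsewhere is a placeholder. *)
Definition gauss (n : nat) (f : R -> R) : R :=
  match n with
  | 2%nat => gauss2 f
  | 3%nat => gauss3 f
  | _ => 0
  end.

Definition lobatto (n : nat) (f : R -> R) : R :=
  match n with
  | 3%nat => lobatto3 f
  | 4%nat => lobatto4 f
  | _ => 0
  end.

(* Main.v *)
Require Import Defs.
From Stdlib Require Import Reals Factorial Lra Lia List.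
From Coquelicot Require Import Coquelicot.
Import ListNotations.
Open Scope R_scope.

(* Finite differences turn (2n-1)-convexity into f^(2n) >= 0 on (-1, 1). With
   J an antiderivative of f, the function H_0(x) = J(x) - J(-x) has derivative
   H_1(x) = f(x) + f(-x), and its even derivatives vanish at 0. Both
   inequalities say that a functional E = c H_0(1) + sum w_i H_1(x_i), with
   nodes in [0,1], is nonnegative.
   Replacing each H_1(x_i) by its Taylor polynomial of degree 2n-1 based at t,
   and H_0(1) by the one of degree 2n, gives a function of t whose derivative is
   the Peano kernel times H_(2n+1) / (2n)!; a node x_i enters the sum when t,
   moving down from 1 to 0, passes x_i. So if the kernel is nonnegative, E is at
   least its value on Taylor polynomials at 0, which is 0 because the quadratures
   are exact in degree 2n-1. *)

(** * Two-sided calculus from one-sided data on the closed interval *)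

Definition clamp (x : R) : R := Rmax (-1) (Rmin 1 x).

Lemma clamp_in (x : R) : I11 (clamp x).
Proof.
  unfold I11, clamp. split; [apply Rmax_l|].
  apply Rmax_lub; [lra|apply Rmin_l].
Qed.

Lemma clamp_id (x : R) : I11 x -> clamp x = x.
Proof.
  intros [h1 h2]. unfold clamp.
  rewrite (Rmin_right 1 x h2). now apply Rmax_right.
Qed.

Lemma clamp_lipschitz (x y : R) : Rabs (clamp y - clamp x) <= Rabs (y - x).
Proof.
  unfold clamp, Rmax, Rmin.
  repeat destruct Rle_dec; unfold Rabs; repeat destruct Rcase_abs; lra.
Qed.

(** Since [clamp] is 1-Lipschitz with values in [I11], a modulus of continuity of [f] along [I11]
    serves on the whole line. This gives two-sided continuity even at the endpoints. *)
Lemma continuous_comp_clamp (f : R -> R) :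
  (forall x, I11 x -> continue_in f I11 x) ->
  forall x, continuous (fun y => f (clamp y)) x.
Proof.
  intros hf x. apply continuity_pt_filterlim.
  intros eps heps.
  destruct (hf (clamp x) (clamp_in x) eps heps) as [d [hd H]].
  exists d; split; [exact hd|]. intros y [_ hy].
  (* The limit in [continue_in] ignores the point itself, so equal clamped values form a separate
     case. *)
  destruct (Req_dec (clamp y) (clamp x)) as [e|e].
  - simpl. unfold Rdist. rewrite e, Rminus_diag, Rabs_R0. exact heps.
  - apply H. split; [split; [apply clamp_in|congruence]|].
    simpl in *. unfold Rdist in *.
    eapply Rle_lt_trans; [apply clamp_lipschitz|exact hy].
Qed.

Lemma is_derive_of_D_in (f f' : R -> R) (x : R) :
  -1 < x < 1 -> D_in f f' I11 x -> is_derive f x (f' x).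
Proof.
  intros [h1 h2] hD. apply is_derive_Reals.
  intros eps heps.
  destruct (hD eps heps) as [d [hd H]].
  assert (hm : 0 < Rmin d (Rmin (1 - x) (x + 1))) by
    (repeat apply Rmin_pos; lra).
  exists (mkposreal _ hm). simpl. intros h hh hlt.
  assert (Rabs h < d) by (eapply Rlt_le_trans; [exact hlt|apply Rmin_l]).
  assert (hq : Rabs h < Rmin (1 - x) (x + 1)) by
    (eapply Rlt_le_trans; [exact hlt|apply Rmin_r]).
  assert (Rabs h < 1 - x) by (eapply Rlt_le_trans; [exact hq|apply Rmin_l]).
  assert (Rabs h < x + 1) by (eapply Rlt_le_trans; [exact hq|apply Rmin_r]).
  assert (-1 <= x + h <= 1) by
    (unfold Rabs in *; destruct (Rcase_abs h); lra).
  specialize (H (x + h)). simpl in H. unfold Rdist in H.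
  replace (x + h - x) with h in H by ring.
  apply H. split; [split; [assumption|lra]|assumption].
Qed.

(** Gathers the nested existential derivatives into one sequence, so that they can be indexed by
    their order. *)
Lemma Ck_on_chain (k : nat) (D : R -> Prop) (f : R -> R) :
  Ck_on k D f ->
  exists F : nat -> R -> R,
    F O = f /\
    (forall j, (j < k)%nat -> forall x, D x -> D_in (F j) (F (S j)) D x) /\
    (forall j, (j <= k)%nat -> forall x, D x -> continue_in (F j) D x).
Proof.
  revert f. induction k as [|k IH]; simpl; intros f hf.
  - exists (fun _ => f). repeat split.
    + intros j hj; lia.
    + intros _ _; exact hf.
  - destruct hf as [f' [hD hC]]. destruct (IH f' hC) as [F [h0 [h1 h2]]].
    exists (fun j => match j with O => f | S i => F i end).
    repeat split.
    + intros [|j] hj x hx; [rewrite h0; now apply hD|apply h1; [lia|exact hx]].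
    + intros [|j] hj x hx; [|apply h2; [lia|exact hx]].
      apply cont_deriv with f'. now apply hD.
Qed.

(** * Finite differences and the sign of the top derivative *)

Lemma divdiff_ext (f : R -> R) (m : nat) (x y : nat -> R) :
  (forall i, (i <= m)%nat -> x i = y i) -> divdiff f m x = divdiff f m y.
Proof.
  revert x y. induction m as [|m IH]; simpl; intros x y h.
  - rewrite h; auto.
  - rewrite (IH x y) by (intros; apply h; lia).
    rewrite (IH (fun i => x (S i)) (fun i => y (S i)))
      by (intros; apply h; lia).
    rewrite (h O), (h (S m)) by lia. reflexivity.
Qed.

(** Differencing the function first suits the induction in [fdiff_neg]; [fdiff_S] recovers the outer
    recursion, which matches [divdiff]. *)
Fixpoint fdiff (h : R) (f : R -> R) (m : nat) (x : R) : R :=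
  match m with
  | O => f x
  | S k => fdiff h (fun y => f (y + h) - f y) k x
  end.

Lemma fdiff_S (h : R) (m : nat) (f : R -> R) (x : R) :
  fdiff h f (S m) x = fdiff h f m (x + h) - fdiff h f m x.
Proof.
  revert f. induction m as [|m IH]; intros f; [reflexivity|].
  change (fdiff h f (S (S m)) x)
    with (fdiff h (fun y => f (y + h) - f y) (S m) x).
  rewrite IH. reflexivity.
Qed.

Lemma divdiff_equispaced (f : R -> R) (h : R) (m : nat) (x : R) :
  h <> 0 ->
  divdiff f m (fun i => x + INR i * h) = fdiff h f m x / (INR (fact m) * h ^ m).
Proof.
  intros hh. revert x. induction m as [|m IH]; intros x.
  - simpl. rewrite Rmult_0_l, Rplus_0_r. field.
  - rewrite fdiff_S.
    cbn [divdiff].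
    rewrite (divdiff_ext f m (fun i => x + INR (S i) * h)
      (fun i => (x + h) + INR i * h)).
    2: { intros i _. rewrite S_INR. ring. }
    rewrite !IH.
    rewrite fact_simpl, mult_INR, <- tech_pow_Rmult.
    assert (INR (S m) <> 0) by (apply not_0_INR; lia).
    assert (INR (fact m) <> 0) by apply INR_fact_neq_0.
    assert (h ^ m <> 0) by now apply pow_nonzero.
    simpl (INR 0). field. repeat split; auto.
    intros e. apply (Rmult_integral_contrapositive_currified _ _ H hh).
    lra.
Qed.

Lemma le_of_derive_nonneg (f f' : R -> R) (a b : R) :
  a <= b ->
  (forall x, a <= x <= b -> continuous f x) ->
  (forall x, a < x < b -> is_derive f x (f' x)) ->
  (forall x, a < x < b -> 0 <= f' x) ->
  f a <= f b.
Proof.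
  intros hab hc hd hp.
  (* [MVT_gen] may return an endpoint, where nothing is known about [f']. *)
  destruct (MVT_gen f a b (fun x => Rabs (f' x))) as [c [_ e]].
  - rewrite Rmin_left, Rmax_right by exact hab. intros x hx.
    rewrite Rabs_pos_eq by now apply hp. now apply hd.
  - rewrite Rmin_left, Rmax_right by exact hab. intros x hx.
    apply continuity_pt_filterlim. now apply hc.
  - assert (0 <= Rabs (f' c) * (b - a))
      by (apply Rmult_le_pos; [apply Rabs_pos|lra]).
    lra.
Qed.

(** The functions [F k (y + h) - F k y] form a chain of derivatives that is one shorter, on (a, b -
    h). By the mean value theorem its last member is again negative. *)
Lemma fdiff_neg (h a b : R) (m : nat) (F : nat -> R -> R) (x : R) :
  0 < h ->
  (forall k, (k < m)%nat -> forall y, a < y < b ->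
     is_derive (F k) y (F (S k) y)) ->
  (forall y, a < y < b -> F m y < 0) ->
  a < x -> x + INR m * h < b ->
  fdiff h (F O) m x < 0.
Proof.
  intros hh. revert b F. induction m as [|m IH]; intros b F hd hn hax hxb.
  - simpl in *. apply hn. lra.
  - cbn [fdiff]. rewrite S_INR in hxb.
    apply (IH (b - h) (fun k y => F k (y + h) - F k y)); [| |exact hax|lra].
    + intros k hk y hy.
      assert (h1 := hd k ltac:(lia) y ltac:(lra)).
      assert (h2 := hd k ltac:(lia) (y + h) ltac:(lra)).
      apply (is_derive_minus (fun y => F k (y + h)) (F k)); [|exact h1].
      replace (F (S k) (y + h)) with (scal 1 (F (S k) (y + h)))
        by (unfold scal; simpl; unfold mult; simpl; ring).
      apply (is_derive_comp (F k) (fun y => y + h)); [exact h2|].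
      auto_derive; [trivial|ring].
    + intros y hy.
      destruct (MVT_gen (F m) y (y + h) (F (S m))) as [c [hc e]].
      * intros z hz. rewrite Rmin_left, Rmax_right in hz by lra.
        apply hd; [lia|lra].
      * intros z hz. rewrite Rmin_left, Rmax_right in hz by lra.
        apply continuity_pt_filterlim.
        apply (ex_derive_continuous (F m)). eexists. apply hd; [lia|lra].
      * rewrite Rmin_left, Rmax_right in hc by lra.
        assert (F (S m) c < 0) by (apply hn; lra).
        rewrite e. nra.
Qed.

(** A negative value would persist near [x] by continuity, and equispaced points taken there would
    have a negative divided difference. *)
Lemma chain_nonneg (m : nat) (F : nat -> R -> R) :
  (forall k, (k < S (S m))%nat -> forall x, -1 < x < 1 ->
     is_derive (F k) x (F (S k) x)) ->
  (forall x, -1 < x < 1 -> continuous (F (S (S m))) x) ->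
  m_convex_on (S m) I11 (F O) ->
  forall x, -1 < x < 1 -> 0 <= F (S (S m)) x.
Proof.
  intros hd hc hconv x hx.
  destruct (Rle_lt_dec 0 (F (S (S m)) x)) as [|hneg]; [assumption|exfalso].
  assert (hcx := proj2 (continuity_pt_filterlim _ _) (hc x hx)).
  destruct (hcx (- F (S (S m)) x) ltac:(lra)) as [d [hdp H]].
  set (e := Rmin d (Rmin (1 - x) (x + 1))).
  assert (he : 0 < e) by (unfold e; repeat apply Rmin_pos; lra).
  assert (hed : e <= d) by apply Rmin_l.
  assert (he1 : e <= 1 - x)
    by (eapply Rle_trans; [apply Rmin_r|apply Rmin_l]).
  assert (he2 : e <= x + 1)
    by (eapply Rle_trans; [apply Rmin_r|apply Rmin_r]).
  set (N := S (S m)) in *.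
  assert (hN : 0 < INR (S N)) by (apply lt_0_INR; lia).
  (* Dividing by N + 1 rather than N keeps the last point x + N h strictly below x + e. *)
  set (h := e / INR (S N)).
  assert (hh : 0 < h) by now apply Rdiv_lt_0_compat.
  assert (hNh : INR N * h < e).
  { replace e with (INR (S N) * h) at 1 by (unfold h; field; lra).
    rewrite S_INR. lra. }
  assert (hlt : fdiff h (F O) N x < 0).
  { apply fdiff_neg with (a := x - e) (b := x + e); [exact hh| | |lra|lra].
    - intros k hk y hy. apply hd; [exact hk|lra].
    - intros y hy. destruct (Req_dec x y) as [<-|hne]; [exact hneg|].
      specialize (H y). simpl in H. unfold Rdist in H.
      assert (Rabs (F N y - F N x) < - F N x).
      { apply H. split; [split; [exact I|exact hne]|].
        apply Rabs_def1; lra. }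
      apply Rabs_def2 in H0. lra. }
  assert (hge := hconv (fun i => x + INR i * h)).
  fold N in hge. rewrite divdiff_equispaced in hge by lra.
  assert (hden : 0 < INR (fact N) * h ^ N)
    by (apply Rmult_lt_0_compat; [apply INR_fact_lt_0|now apply pow_lt]).
  assert (0 <= fdiff h (F O) N x / (INR (fact N) * h ^ N)).
  { apply hge.
    - intros i hi. apply le_INR in hi. assert (0 <= INR i) by apply pos_INR.
      unfold I11. nra.
    - intros i j _ _ hij e'. apply hij, INR_eq.
      apply Rmult_eq_reg_r with h; lra. }
  assert (fdiff h (F O) N x / (INR (fact N) * h ^ N) < 0)
    by (apply Rdiv_neg_pos; assumption).
  lra.
Qed.

(** * Taylor polynomials as functions of their base point, and Peano kernels *)

Definition taylor (d : nat) (F : nat -> R -> R) (s t : R) : R :=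
  sum_f_R0 (fun i => F i t * ((s - t) ^ i / INR (fact i))) d.

(** The evaluation point [s] is fixed and the base [t] moves. Differentiating [F i t] in one term
    cancels differentiating the power in the next, so only the top term survives. *)
Lemma is_derive_taylor (d : nat) (F : nat -> R -> R) (s t : R) :
  (forall k, (k <= d)%nat -> is_derive (F k) t (F (S k) t)) ->
  is_derive (taylor d F s) t (F (S d) t * ((s - t) ^ d / INR (fact d))).
Proof.
  induction d as [|d IH]; intros hd.
  - assert (h0 := hd O (le_n _)). unfold taylor; simpl.
    apply (is_derive_ext (F O)); [intros u; simpl; field|].
    now replace (F 1%nat t * (1 / 1)) with (F 1%nat t) by field.
  - assert (h1 := IH (fun k hk => hd k (le_S _ _ hk))).
    assert (h2 := hd (S d) (le_n _)).
    unfold taylor in *. cbn [sum_f_R0].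
    set (X := F (S (S d)) t * ((s - t) ^ S d / INR (fact (S d)))).
    replace X with
      (F (S d) t * ((s - t) ^ d / INR (fact d)) +
        (X - F (S d) t * ((s - t) ^ d / INR (fact d)))) by ring.
    apply (is_derive_plus (taylor d F s)); [exact h1|].
    auto_derive; [repeat split; eexists; exact h2|].
    change (Derive (fun x => F (S d) x) t) with (Derive (F (S d)) t).
    rewrite (is_derive_unique _ _ _ h2). unfold X.
    change (match d with O => 1 | S _ => INR d + 1 end) with (INR (S d)).
    change (fact d + d * fact d)%nat with (fact (S d)).
    rewrite fact_simpl, mult_INR, <- tech_pow_Rmult.
    assert (INR (S d) <> 0) by (apply not_0_INR; lia).
    assert (INR (fact d) <> 0) by apply INR_fact_neq_0.
    unfold Rminus. field. auto.
Qed.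

Lemma continuous_taylor (d : nat) (F : nat -> R -> R) (s t : R) :
  (forall k, (k <= d)%nat -> continuous (F k) t) ->
  continuous (taylor d F s) t.
Proof.
  assert (hp : forall i, continuous (fun u => (s - u) ^ i / INR (fact i)) t).
  { intros i. apply (ex_derive_continuous (fun u => (s - u) ^ i / INR (fact i))).
    auto_derive. trivial. }
  induction d as [|d IH]; intros hc; unfold taylor; cbn [sum_f_R0].
  - apply (continuous_mult (K := R_AbsRing) (F _)); [now apply hc|apply (hp O)].
  - apply (continuous_plus (V := R_NormedModule) (taylor d F s));
      [apply IH; intros; apply hc; lia|].
    apply (continuous_mult (K := R_AbsRing) (F _)); [now apply hc|apply (hp (S d))].
Qed.

Lemma taylor_diag (d : nat) (F : nat -> R -> R) (s : R) :
  taylor d F s s = F O s.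
Proof.
  unfold taylor. induction d as [|d IH]; simpl; [field|].
  rewrite IH, Rminus_diag, Rmult_0_l. unfold Rdiv. ring.
Qed.

(* The pairs in [l] are (weight, node). *)
Definition wsum (g : R -> R) (l : list (R * R)) : R :=
  fold_right (fun p acc => fst p * g (snd p) + acc) 0 l.

(** Here [m] is 2n - 1. The polynomial of [H 0] has one degree more than those of [H 1], so that all
    derivatives in [t] carry the common factor [H (m+2)]. *)
Definition expansion (m : nat) (H : nat -> R -> R) (c : R) (l : list (R * R))
    (t : R) : R :=
  c * taylor (S m) H 1 t + wsum (fun s => taylor m (fun k => H (S k)) s t) l.

(* The derivative of [expansion] is this times [H (m+2) / (m+1)!]. *)
Definition kernel (m : nat) (c : R) (l : list (R * R)) (t : R) : R :=
  c * (1 - t) ^ S m + INR (S m) * wsum (fun s => (s - t) ^ m) l.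

Definition antiderivs (N : nat) (H : nat -> R -> R) : Prop :=
  (forall k, (k < N)%nat -> forall t, 0 <= t <= 1 -> continuous (H k) t) /\
  (forall k, (k < N)%nat -> forall t, 0 < t < 1 ->
     is_derive (H k) t (H (S k) t)) /\
  (forall t, 0 < t < 1 -> 0 <= H N t).

Lemma is_derive_wsum (g : R -> R -> R) (g' : R -> R) (l : list (R * R)) (t : R) :
  (forall s, is_derive (g s) t (g' s)) ->
  is_derive (fun u => wsum (fun s => g s u) l) t (wsum g' l).
Proof.
  intros hg. induction l as [|[w s] l IH]; simpl.
  - apply (is_derive_const (V := R_NormedModule) 0 t).
  - apply (is_derive_plus (fun u => w * g s u)); [|exact IH].
    apply (is_derive_scal (g s) t w). apply hg.
Qed.

Lemma continuous_wsum (g : R -> R -> R) (l : list (R * R)) (t : R) :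
  (forall s, continuous (g s) t) ->
  continuous (fun u => wsum (fun s => g s u) l) t.
Proof.
  intros hg. induction l as [|[w s] l IH]; simpl.
  - apply continuous_const.
  - apply (continuous_plus (V := R_NormedModule) (fun u => w * g s u));
      [|exact IH].
    apply (continuous_scal_r (V := R_NormedModule) w (g s)). apply hg.
Qed.

Lemma wsum_scal (a : R) (g : R -> R) (l : list (R * R)) :
  wsum (fun s => a * g s) l = a * wsum g l.
Proof.
  induction l as [|[w s] l IH]; simpl; [ring|].
  rewrite IH. ring.
Qed.

Lemma wsum_ext (g g' : R -> R) (l : list (R * R)) :
  (forall s, g s = g' s) -> wsum g l = wsum g' l.
Proof.
  intros h. induction l as [|[w s] l IH]; simpl; [reflexivity|].
  now rewrite IH, h.
Qed.

(** The derivative is a product of two nonnegative factors. The lemma is applied between consecutive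
    nodes, with [l] listing the nodes already passed, those at or above [b]. *)
Lemma expansion_le (m : nat) (H : nat -> R -> R) (c : R) (l : list (R * R))
    (a b : R) :
  antiderivs (S (S m)) H -> 0 <= a -> a <= b -> b <= 1 ->
  (forall t, a < t < b -> 0 <= kernel m c l t) ->
  expansion m H c l a <= expansion m H c l b.
Proof.
  intros [hc [hd hp]] ha hab hb hK.
  apply (le_of_derive_nonneg _
    (fun t => H (S (S m)) t / INR (fact (S m)) * kernel m c l t)); [exact hab| | |].
  - intros t ht. unfold expansion.
    apply (continuous_plus (V := R_NormedModule)
      (fun t => c * taylor (S m) H 1 t)).
    + apply (continuous_scal_r (V := R_NormedModule) c (taylor (S m) H 1)).
      apply continuous_taylor. intros k hk. apply hc; [lia|lra].
    + apply continuous_wsum. intros s. apply continuous_taylor.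
      intros k hk. apply hc; [lia|lra].
  - intros t ht.
    replace (H (S (S m)) t / INR (fact (S m)) * kernel m c l t) with
      (c * (H (S (S m)) t * ((1 - t) ^ S m / INR (fact (S m)))) +
       wsum (fun s => H (S (S m)) t * ((s - t) ^ m / INR (fact m))) l).
    + apply (is_derive_plus (fun t => c * taylor (S m) H 1 t)).
      * apply (is_derive_scal (taylor (S m) H 1) t c).
        apply is_derive_taylor. intros k hk. apply hd; [lia|lra].
      * apply is_derive_wsum. intros s.
        apply (is_derive_taylor m (fun k => H (S k))).
        intros k hk. apply hd; [lia|lra].
    + rewrite (wsum_ext _ (fun s => H (S (S m)) t / INR (fact m) * (s - t) ^ m))
        by (intros s; unfold Rdiv; ring).
      rewrite wsum_scal. unfold kernel. rewrite fact_simpl, mult_INR.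
      assert (INR (S m) <> 0) by (apply not_0_INR; lia).
      assert (INR (fact m) <> 0) by apply INR_fact_neq_0.
      field. auto.
  - intros t ht. apply Rmult_le_pos; [|now apply hK].
    apply Rdiv_le_0_compat; [apply hp; lra|apply INR_fact_lt_0].
Qed.

Lemma expansion_last (m : nat) (H : nat -> R -> R) (c : R) :
  expansion m H c [] 1 = c * H O 1.
Proof. unfold expansion. rewrite taylor_diag. simpl. ring. Qed.

(** A Taylor polynomial based at its evaluation point is exact there, so a node can join the list at
    [t = s] at the price of its own term. *)
Lemma expansion_node (m : nat) (H : nat -> R -> R) (c w s : R)
    (l : list (R * R)) :
  expansion m H c ((w, s) :: l) s = w * H 1%nat s + expansion m H c l s.
Proof. unfold expansion. simpl wsum. rewrite taylor_diag. ring. Qed.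

(** * Nonnegativity of the kernels *)

Lemma weighted_am_gm_4 (x d : R) :
  0 <= x -> 0 <= d -> 256 * d * x ^ 3 <= 27 * (x + d) ^ 4.
Proof.
  intros hx hd.
  (* Arithmetic-geometric mean for three copies of x/3 and one of d; equality at x = 3d explains the
     square. *)
  assert (0 <= (x - 3 * d) ^ 2 * (27 * x ^ 2 + 14 * (x * d) + 3 * d ^ 2)).
  { apply Rmult_le_pos; [apply pow2_ge_0|].
    assert (0 <= x * d) by now apply Rmult_le_pos.
    assert (hx2 := pow2_ge_0 x). assert (hd2 := pow2_ge_0 d). lra. }
  lra.
Qed.

Lemma weighted_am_gm_6 (x d : R) :
  0 <= x -> 0 <= d -> 46656 * d * x ^ 5 <= 3125 * (x + d) ^ 6.
Proof.
  intros hx hd.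
  (* The same with five copies of x/5, hence equality at x = 5d. *)
  assert (0 <= (x - 5 * d) ^ 2 * (3125 * x ^ 4 + 3344 * (x ^ 3 * d) +
    2190 * (x ^ 2 * d ^ 2) + 800 * (x * d ^ 3) + 125 * d ^ 4)).
  { apply Rmult_le_pos; [apply pow2_ge_0|].
    assert (0 <= x ^ 4) by now apply pow_le.
    assert (0 <= x ^ 3 * d) by (apply Rmult_le_pos; [now apply pow_le|lra]).
    assert (0 <= x ^ 2 * d ^ 2)
      by (apply Rmult_le_pos; now apply pow_le).
    assert (0 <= x * d ^ 3) by (apply Rmult_le_pos; [lra|now apply pow_le]).
    assert (0 <= d ^ 4) by now apply pow_le.
    lra. }
  lra.
Qed.

(** Replacing [x * x] by a rational leaves an expression linear in the irrational node, so decimal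
    bounds on the node can settle its sign. *)
Lemma pow3_minus (x q t : R) :
  x * x = q -> (x - t) ^ 3 = q * x - 3 * q * t + 3 * x * t ^ 2 - t ^ 3.
Proof. intros <-. ring. Qed.

Lemma pow5_minus (x q t : R) :
  x * x = q ->
  (x - t) ^ 5 = q ^ 2 * x - 5 * q ^ 2 * t + 10 * q * x * t ^ 2
    - 10 * q * t ^ 3 + 5 * x * t ^ 4 - t ^ 5.
Proof. intros <-. ring. Qed.

(** Bernstein form of degree 6: nonnegative coefficients certify a nonnegative polynomial on
    [0, 1]. *)
Lemma bernstein_nonneg (u b0 b1 b2 b3 b4 b5 b6 : R) :
  0 <= u <= 1 ->
  0 <= b0 -> 0 <= b1 -> 0 <= b2 -> 0 <= b3 -> 0 <= b4 -> 0 <= b5 -> 0 <= b6 ->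
  0 <= b0 * (1 - u) ^ 6 + 6 * b1 * (u * (1 - u) ^ 5)
    + 15 * b2 * (u ^ 2 * (1 - u) ^ 4) + 20 * b3 * (u ^ 3 * (1 - u) ^ 3)
    + 15 * b4 * (u ^ 4 * (1 - u) ^ 2) + 6 * b5 * (u ^ 5 * (1 - u))
    + b6 * u ^ 6.
Proof.
  intros hu h0 h1 h2 h3 h4 h5 h6.
  assert (hp : forall i, 0 <= u ^ i) by (intros; apply pow_le; lra).
  assert (hq : forall i, 0 <= (1 - u) ^ i) by (intros; apply pow_le; lra).
  repeat apply Rplus_le_le_0_compat;
    repeat apply Rmult_le_pos; first [apply hp | apply hq | lra].
Qed.

(** The mean inequality with d = 1 - r reduces this to 256 (1 - r) >= 4 * 27, that is r <= 37/64 =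
    0.578125; hence the three-digit bound on [r]. *)
Lemma kernel_gauss2 (r t : R) :
  0 < r -> r * r = 1 / 3 -> t <= r -> 4 * (r - t) ^ 3 <= (1 - t) ^ 4.
Proof.
  intros h0 hr ht.
  assert (577 / 1000 < r < 578 / 1000) by (split; nra).
  assert (h := weighted_am_gm_4 (r - t) (1 - r) ltac:(lra) ltac:(lra)).
  replace (r - t + (1 - r)) with (1 - t) in h by ring.
  assert (0 <= (r - t) ^ 3) by (apply pow_le; lra).
  nra.
Qed.

Lemma kernel_gauss3 (r t : R) :
  0 < r -> r * r = 3 / 5 -> t <= r -> 10 / 3 * (r - t) ^ 5 <= (1 - t) ^ 6.
Proof.
  intros h0 hr ht.
  assert (7745 / 10000 < r < 7746 / 10000) by (split; nra).
  assert (h := weighted_am_gm_6 (r - t) (1 - r) ltac:(lra) ltac:(lra)).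
  replace (r - t + (1 - r)) with (1 - t) in h by ring.
  assert (0 <= (r - t) ^ 5) by (apply pow_le; lra).
  nra.
Qed.

Lemma kernel_lobatto3 (r t : R) :
  0 < r -> r * r = 1 / 3 -> 0 <= t <= r ->
  0 <= 4 / 3 * (1 - t) ^ 3 + 4 * (r - t) ^ 3 - 2 * (1 - t) ^ 4.
Proof.
  intros h0 hr ht.
  assert (577 / 1000 < r < 578 / 1000) by (split; nra).
  (* From 1/3 on, the powers of 1 - t combine to a nonnegative product; below 1/3 the term in r - t
     must compensate. *)
  destruct (Rle_lt_dec (1 / 3) t) as [h|h].
  - replace (4 / 3 * (1 - t) ^ 3 + 4 * (r - t) ^ 3 - 2 * (1 - t) ^ 4) with
      ((1 - t) ^ 3 * (2 * t - 2 / 3) + 4 * (r - t) ^ 3) by field.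
    assert (0 <= (1 - t) ^ 3) by (apply pow_le; lra).
    assert (0 <= (r - t) ^ 3) by (apply pow_le; lra).
    nra.
  - rewrite (pow3_minus r _ t hr).
    nra.
Qed.

(** The stretch needed is (s, r) with s = sqrt 5 / 5; the rational bound 2/5 < s allows a Bernstein
    form with rational endpoints. *)
Lemma kernel_lobatto4_upper (r t : R) :
  r * r = 3 / 5 -> 2 / 5 <= t <= r -> t <= 1 ->
  0 <= (1 - t) ^ 5 + 10 / 3 * (r - t) ^ 5 - 2 * (1 - t) ^ 6.
Proof.
  intros hr ht ht1.
  assert (7745 / 10000 < r < 7746 / 10000) by (split; nra).
  destruct (Rle_lt_dec (1 / 2) t) as [h|h].
  - replace ((1 - t) ^ 5 + 10 / 3 * (r - t) ^ 5 - 2 * (1 - t) ^ 6) with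
      ((1 - t) ^ 5 * (2 * t - 1) + 10 / 3 * (r - t) ^ 5) by field.
    assert (0 <= (1 - t) ^ 5) by (apply pow_le; lra).
    assert (0 <= (r - t) ^ 5) by (apply pow_le; lra).
    nra.
  - (* Bernstein coefficients on [2/5, 1/2], once even powers of [r] are
       reduced. *)
    assert (hB := bernstein_nonneg (10 * t - 4)
      (- 174829 / 46875 + 362 / 75 * r)
      (- 89821 / 22500 + 1162 / 225 * r)
      (- 48071 / 11250 + 6217 / 1125 * r)
      (- 9147 / 2000 + 887 / 150 * r)
      (- 17621 / 3600 + 11389 / 1800 * r)
      (- 3017 / 576 + 2437 / 360 * r)
      (- 269 / 48 + 869 / 120 * r)).
    rewrite (pow5_minus r _ t hr).
    match type of hB with _ -> _ -> _ -> _ -> _ -> _ -> _ -> _ -> 0 <= ?b =>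
      match goal with |- 0 <= ?g => replace g with b by field end end.
    apply hB; lra.
Qed.

(** Since s < 1/2, a single Bernstein form on [0, 1/2] covers the stretch. *)
Lemma kernel_lobatto4_lower (r s t : R) :
  0 < r -> r * r = 3 / 5 -> 0 < s -> s * s = 1 / 5 -> 0 <= t <= s ->
  0 <= (1 - t) ^ 5 + 10 / 3 * (r - t) ^ 5 + 5 * (s - t) ^ 5 - 2 * (1 - t) ^ 6.
Proof.
  intros h0 hr hs0 hs ht.
  assert (7745 / 10000 < r < 7746 / 10000) by (split; nra).
  assert (4472 / 10000 < s < 4473 / 10000) by (split; nra).
  (* Bernstein coefficients on [0, 1/2], after the same reduction. *)
  assert (hB := bernstein_nonneg (2 * t)
    (- 1 + 6 / 5 * r + 1 / 5 * s)
    (- 1 + 6 / 5 * r + 1 / 5 * s)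
    (- 4 / 3 + 23 / 15 * r + 11 / 30 * s)
    (- 2 + 11 / 5 * r + 7 / 10 * s)
    (- 149 / 48 + 1177 / 360 * r + 313 / 240 * s)
    (- 697 / 144 + 1757 / 360 * r + 191 / 80 * s)
    (- 721 / 96 + 869 / 120 * r + 341 / 80 * s)).
  rewrite (pow5_minus r _ t hr), (pow5_minus s _ t hs).
  match type of hB with _ -> _ -> _ -> _ -> _ -> _ -> _ -> _ -> 0 <= ?b =>
    match goal with |- 0 <= ?g => replace g with b by field end end.
  apply hB; lra.
Qed.

(** * The quadrature inequalities on the half interval [0, 1] *)

Lemma gauss2_half (H : nat -> R -> R) (r : R) :
  0 < r -> r * r = 1 / 3 -> antiderivs 5 H ->
  (forall k, H (2 * k)%nat 0 = 0) ->
  H 1%nat r <= H O 1.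
Proof.
  intros h0 hr hH he.
  assert (hr1 : r < 1) by nra.
  assert (p1 : expansion 3 H 1 [] r <= expansion 3 H 1 [] 1).
  { apply expansion_le; try assumption; try lra.
    intros t ht. replace (kernel 3 1 [] t) with ((1 - t) ^ 4)
      by (unfold kernel; simpl; ring).
    apply pow_le. lra. }
  assert (p2 : expansion 3 H 1 [(-1, r)] 0 <= expansion 3 H 1 [(-1, r)] r).
  { apply expansion_le; try assumption; try lra.
    intros t ht. replace (kernel 3 1 [(-1, r)] t)
      with ((1 - t) ^ 4 - 4 * (r - t) ^ 3) by (unfold kernel; simpl; ring).
    assert (h := kernel_gauss2 r t h0 hr). lra. }
  rewrite expansion_node in p2. rewrite expansion_last in p1.
  assert (p0 : expansion 3 H 1 [(-1, r)] 0 = 0).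
  { assert (e0 := he 0%nat). assert (e2 := he 1%nat).
    assert (e4 := he 2%nat). simpl in e0, e2, e4.
    unfold expansion, taylor. simpl. rewrite e0, e2, e4.
    (* The coefficient of [H 3] vanishes because the Gauss rule is exact on t^2. *)
    transitivity ((1 / 6 - (r * r) / 2) * H 3%nat 0); [field|].
    rewrite hr. field. }
  lra.
Qed.

(** The upper estimate rearranged: twice the integral is at most the Lobatto sum plus the Gauss sum.
    The node 0 counts once in [H 1 0 = 2 f(0)], so its weight is halved. *)
Lemma lobatto3_half (H : nat -> R -> R) (r : R) :
  0 < r -> r * r = 1 / 3 -> antiderivs 5 H ->
  (forall k, H (2 * k)%nat 0 = 0) ->
  2 * H O 1 <= 1 / 3 * H 1%nat 1 + 2 / 3 * H 1%nat 0 + H 1%nat r.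
Proof.
  intros h0 hr hH he.
  assert (hr1 : 1 / 3 < r < 1) by (split; nra).
  assert (p1 : expansion 3 H (-2) [(1 / 3, 1)] r
               <= expansion 3 H (-2) [(1 / 3, 1)] 1).
  { apply expansion_le; try assumption; try lra.
    intros t ht. replace (kernel 3 (-2) [(1 / 3, 1)] t)
      with ((1 - t) ^ 3 * (2 * t - 2 / 3)) by (unfold kernel; simpl; field).
    apply Rmult_le_pos; [apply pow_le|]; lra. }
  assert (p2 : expansion 3 H (-2) [(1, r); (1 / 3, 1)] 0
               <= expansion 3 H (-2) [(1, r); (1 / 3, 1)] r).
  { apply expansion_le; try assumption; try lra.
    intros t ht. replace (kernel 3 (-2) [(1, r); (1 / 3, 1)] t)
      with (4 / 3 * (1 - t) ^ 3 + 4 * (r - t) ^ 3 - 2 * (1 - t) ^ 4)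
      by (unfold kernel; simpl; field).
    apply kernel_lobatto3; lra. }
  rewrite expansion_node in p2. rewrite expansion_node, expansion_last in p1.
  assert (p0 : expansion 3 H (-2) [(1, r); (1 / 3, 1)] 0
               = - (2 / 3) * H 1%nat 0).
  { assert (e0 := he 0%nat). assert (e2 := he 1%nat).
    assert (e4 := he 2%nat). simpl in e0, e2, e4.
    unfold expansion, taylor. simpl. rewrite e0, e2, e4.
    transitivity (- (2 / 3) * H 1%nat 0 + ((r * r) / 2 - 1 / 6) * H 3%nat 0);
      [field|].
    rewrite hr. field. }
  lra.
Qed.

Lemma gauss3_half (H : nat -> R -> R) (r : R) :
  0 < r -> r * r = 3 / 5 -> antiderivs 7 H ->
  (forall k, H (2 * k)%nat 0 = 0) ->
  4 / 9 * H 1%nat 0 + 5 / 9 * H 1%nat r <= H O 1.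
Proof.
  intros h0 hr hH he.
  assert (hr1 : r < 1) by nra.
  assert (p1 : expansion 5 H 1 [] r <= expansion 5 H 1 [] 1).
  { apply expansion_le; try assumption; try lra.
    intros t ht. replace (kernel 5 1 [] t) with ((1 - t) ^ 6)
      by (unfold kernel; simpl; ring).
    apply pow_le. lra. }
  assert (p2 : expansion 5 H 1 [(- (5 / 9), r)] 0
               <= expansion 5 H 1 [(- (5 / 9), r)] r).
  { apply expansion_le; try assumption; try lra.
    intros t ht. replace (kernel 5 1 [(- (5 / 9), r)] t)
      with ((1 - t) ^ 6 - 10 / 3 * (r - t) ^ 5) by (unfold kernel; simpl; field).
    assert (h := kernel_gauss3 r t h0 hr). lra. }
  rewrite expansion_node in p2. rewrite expansion_last in p1.
  (* The node 0 never joins the list: its term is what remains of the expansion at 0. *)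
  assert (p0 : expansion 5 H 1 [(- (5 / 9), r)] 0 = 4 / 9 * H 1%nat 0).
  { assert (e0 := he 0%nat). assert (e2 := he 1%nat).
    assert (e4 := he 2%nat). assert (e6 := he 3%nat).
    simpl in e0, e2, e4, e6.
    unfold expansion, taylor. simpl. rewrite e0, e2, e4, e6.
    transitivity (4 / 9 * H 1%nat 0 + (1 / 6 - 5 / 18 * (r * r)) * H 3%nat 0
      + (1 / 120 - 5 / 216 * ((r * r) * (r * r))) * H 5%nat 0); [field|].
    rewrite hr. field. }
  lra.
Qed.

Lemma lobatto4_half (H : nat -> R -> R) (r s : R) :
  0 < r -> r * r = 3 / 5 -> 0 < s -> s * s = 1 / 5 ->
  antiderivs 7 H -> (forall k, H (2 * k)%nat 0 = 0) ->
  2 * H O 1 <= 1 / 6 * H 1%nat 1 + 5 / 9 * H 1%nat r + 5 / 6 * H 1%nat s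
    + 4 / 9 * H 1%nat 0.
Proof.
  intros h0 hr hs0 hs hH he.
  (* [1 / 2 < r] gives the sign of the kernel on (r, 1); [2 / 5 < s] puts (s, r) within reach of
     [kernel_lobatto4_upper]. *)
  assert (hr1 : 1 / 2 < r < 1) by (split; nra).
  assert (hs1 : 2 / 5 < s < 1 / 2) by (split; nra).
  set (l1 := [(1 / 6, 1)]). set (l2 := (5 / 9, r) :: l1).
  set (l3 := (5 / 6, s) :: l2).
  assert (p1 : expansion 5 H (-2) l1 r <= expansion 5 H (-2) l1 1).
  { apply expansion_le; try assumption; try lra.
    intros t ht. replace (kernel 5 (-2) l1 t)
      with ((1 - t) ^ 5 * (2 * t - 1)) by (unfold kernel; simpl; field).
    apply Rmult_le_pos; [apply pow_le|]; lra. }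
  assert (p2 : expansion 5 H (-2) l2 s <= expansion 5 H (-2) l2 r).
  { apply expansion_le; try assumption; try lra.
    intros t ht. replace (kernel 5 (-2) l2 t)
      with ((1 - t) ^ 5 + 10 / 3 * (r - t) ^ 5 - 2 * (1 - t) ^ 6)
      by (unfold kernel; simpl; field).
    apply kernel_lobatto4_upper; lra. }
  assert (p3 : expansion 5 H (-2) l3 0 <= expansion 5 H (-2) l3 s).
  { apply expansion_le; try assumption; try lra.
    intros t ht. replace (kernel 5 (-2) l3 t)
      with ((1 - t) ^ 5 + 10 / 3 * (r - t) ^ 5 + 5 * (s - t) ^ 5
            - 2 * (1 - t) ^ 6)
      by (unfold kernel; simpl; field).
    apply kernel_lobatto4_lower; lra. }
  (* Only the right-hand list is opened, where the base equals the head node and [expansion_node]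
     can strip it. *)
  unfold l3 in p3 at 2. unfold l2 in p2 at 2. unfold l1 in p1 at 2.
  rewrite expansion_node in p1, p2, p3. rewrite expansion_last in p1.
  assert (p0 : expansion 5 H (-2) l3 0 = - (4 / 9) * H 1%nat 0).
  { assert (e0 := he 0%nat). assert (e2 := he 1%nat).
    assert (e4 := he 2%nat). assert (e6 := he 3%nat).
    simpl in e0, e2, e4, e6.
    unfold expansion, taylor. simpl. rewrite e0, e2, e4, e6.
    transitivity (- (4 / 9) * H 1%nat 0
      + (- 1 / 4 + 5 / 18 * (r * r) + 5 / 12 * (s * s)) * H 3%nat 0
      + (- 7 / 720 + 5 / 216 * ((r * r) * (r * r))
         + 5 / 144 * ((s * s) * (s * s))) * H 5%nat 0); [field|].
    rewrite hr, hs. field. }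
  lra.
Qed.

(** * Construction of the chain from [f], and the conclusion *)

(* When [H k] is the k-th derivative of [G], [odd_chain H k] is the k-th
   derivative of [x |-> G x - G (- x)]. *)
Definition odd_chain (H : nat -> R -> R) (k : nat) (t : R) : R :=
  H k t - (-1) ^ k * H k (- t).

Lemma is_derive_odd_chain (H : nat -> R -> R) (k : nat) (t : R) :
  is_derive (H k) t (H (S k) t) -> is_derive (H k) (- t) (H (S k) (- t)) ->
  is_derive (odd_chain H k) t (odd_chain H (S k) t).
Proof.
  intros h1 h2. unfold odd_chain.
  replace (H (S k) t - (-1) ^ S k * H (S k) (- t)) with
    (H (S k) t - (-1) ^ k * (scal (-1) (H (S k) (- t))))
    by (unfold scal; simpl; unfold mult; simpl; ring).
  apply (is_derive_minus (H k)); [exact h1|].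
  apply (is_derive_scal (fun t => H k (- t))).
  apply (is_derive_comp (H k) (fun t => - t)); [exact h2|].
  auto_derive; [trivial|ring].
Qed.

Lemma continuous_odd_chain (H : nat -> R -> R) (k : nat) (t : R) :
  continuous (H k) t -> continuous (H k) (- t) ->
  continuous (odd_chain H k) t.
Proof.
  intros h1 h2. unfold odd_chain.
  apply (continuous_minus (V := R_NormedModule) (H k)); [exact h1|].
  apply (continuous_scal_r (V := R_NormedModule) ((-1) ^ k) (fun t => H k (- t))).
  apply (continuous_comp (fun t => - t) (H k)); [|exact h2].
  apply (ex_derive_continuous (fun t : R => - t)). auto_derive. trivial.
Qed.

(** With m = 2n - 2, the chain ends at index 2n + 1, which is odd; there the two reflected values of
    the top derivative add up and keep its sign. *)
Lemma exists_antiderivs (m : nat) (f : R -> R) :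
  Ck_on (S (S m)) I11 f -> m_convex_on (S m) I11 f -> Nat.Even m ->
  exists H : nat -> R -> R,
    H O 1 = RInt f (-1) 1 /\
    (forall t, 0 <= t <= 1 -> H 1%nat t = f t + f (- t)) /\
    antiderivs (S (S (S m))) H /\
    (forall k, H (2 * k)%nat 0 = 0).
Proof.
  intros hC hconv hm.
  destruct (Ck_on_chain _ _ _ hC) as [F [F0 [Fd Fc]]].
  assert (Fd' : forall k, (k < S (S m))%nat -> forall x, -1 < x < 1 ->
    is_derive (F k) x (F (S k) x)).
  { intros k hk x hx. apply is_derive_of_D_in; [exact hx|].
    apply Fd; [exact hk|unfold I11; lra]. }
  (* Constant continuation beyond [-1, 1]: continuous everywhere, and locally equal to [F k]
     inside. *)
  set (E := fun k x => F k (clamp x)).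
  assert (Ec : forall k, (k <= S (S m))%nat -> forall x, continuous (E k) x)
    by (intros k hk; apply continuous_comp_clamp; now apply Fc).
  assert (EF : forall k x, -1 < x < 1 -> locally x (fun y => F k y = E k y)).
  { intros k x hx. apply (locally_interval _ x (-1) 1); simpl; try lra.
    intros y h1 h2. unfold E. rewrite clamp_id; [reflexivity|unfold I11; lra]. }
  assert (Ed : forall k, (k < S (S m))%nat -> forall x, -1 < x < 1 ->
    is_derive (E k) x (E (S k) x)).
  { intros k hk x hx.
    replace (E (S k) x) with (F (S k) x)
      by exact (locally_singleton _ _ (EF (S k) x hx)).
    apply is_derive_ext_loc with (F k); [now apply EF|now apply Fd']. }
  assert (En : forall x, -1 < x < 1 -> 0 <= E (S (S m)) x).
  { intros x hx.
    replace (E (S (S m)) x) with (F (S (S m)) x)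
      by exact (locally_singleton _ _ (EF (S (S m)) x hx)).
    apply chain_nonneg; [exact Fd'| |now rewrite F0|exact hx].
    intros y hy. apply (continuous_ext_loc (F (S (S m))) (E (S (S m))) y);
      [|now apply Ec].
    generalize (EF (S (S m)) y hy). apply filter_imp.
    intros z e. now symmetry. }
  assert (Ei : forall a b, ex_RInt (E O) a b).
  { intros a b. apply (ex_RInt_continuous (V := R_CompleteNormedModule)).
    intros z _. apply Ec. lia. }
  (* Indices shift by one: [G 0] is the primitive of the extended [f] vanishing at 0, and [G 1] is
     that extension. *)
  set (G := fun k => match k with O => RInt (E O) 0 | S j => E j end).
  assert (G0d : forall x, is_derive (G O) x (G 1%nat x)).
  { intros x. apply (is_derive_RInt (V := R_CompleteNormedModule) _ _ 0).
    - apply filter_forall. intros y.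
      apply (RInt_correct (V := R_CompleteNormedModule)). apply Ei.
    - apply Ec. lia. }
  assert (Gd : forall k, (k < S (S (S m)))%nat -> forall x, -1 < x < 1 ->
    is_derive (G k) x (G (S k) x)).
  { intros [|k] hk x hx; [apply G0d|]. apply Ed; [lia|exact hx]. }
  assert (Gc : forall k, (k < S (S (S m)))%nat -> forall x, continuous (G k) x).
  { intros [|k] hk x; [|apply Ec; lia].
    apply (ex_derive_continuous (G O)). eexists. apply G0d. }
  exists (odd_chain G).
  split; [|split; [|split; [split; [|split]|]]].
  - unfold odd_chain. simpl.
    rewrite (RInt_ext f (E O)).
    2: { intros x hx. rewrite Rmin_left, Rmax_right in hx by lra.
         unfold E. rewrite F0, clamp_id; [reflexivity|unfold I11; lra]. }
    rewrite <- (RInt_Chasles (E O) (-1) 0 1) by apply Ei.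
    rewrite <- (opp_RInt_swap (E O) 0 (-1)) by apply Ei.
    unfold plus, opp; simpl. replace (- (1)) with (-1) by ring. ring.
  - intros t ht. unfold odd_chain, G, E.
    rewrite F0, !clamp_id by (unfold I11; lra). ring.
  - intros k hk t ht. apply continuous_odd_chain; now apply Gc.
  - intros k hk t ht. apply is_derive_odd_chain; apply Gd; (assumption || lra).
  - intros t ht. unfold odd_chain.
    destruct hm as [p hp].
    replace ((-1) ^ S (S (S m))) with ((-1) ^ S (2 * S p)) by (f_equal; lia).
    rewrite pow_1_odd.
    assert (h1 := En t ltac:(lra)). assert (h2 := En (- t) ltac:(lra)).
    unfold G. lra.
  - intros k. unfold odd_chain. rewrite pow_1_even, Ropp_0. ring.
Qed.

Lemma sqrt_ratio_sq (a b : R) :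
  0 < a -> 0 < b -> 0 < sqrt a / b /\ sqrt a / b * (sqrt a / b) = a / (b * b).
Proof.
  intros ha hb. split.
  - apply Rdiv_lt_0_compat; [now apply sqrt_lt_R0|exact hb].
  - replace (sqrt a / b * (sqrt a / b)) with (sqrt a * sqrt a / (b * b))
      by (field; lra).
    now rewrite sqrt_sqrt by lra.
Qed.

Theorem theorem5 (n : nat) (hn : n = 2%nat \/ n = 3%nat) (f : R -> R)
    (hC : Ck_on (2 * n) I11 f) (hconv : m_convex_on (2 * n - 1) I11 f) :
  0 <= RInt f (-1) 1 - gauss n f <= lobatto (n + 1) f - RInt f (-1) 1.
Proof.
  destruct hn as [-> | ->].
  - destruct (exists_antiderivs 2 f hC hconv) as [H [h0 [h1 [hH he]]]];
      [now exists 1%nat|].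
    destruct (sqrt_ratio_sq 3 3) as [r0 hr]; [lra|lra|].
    unfold gauss, gauss2. simpl lobatto. unfold lobatto3.
    set (r := sqrt 3 / 3) in *.
    replace (3 / (3 * 3)) with (1 / 3) in hr by field.
    assert (hG := gauss2_half H r r0 hr hH he).
    assert (hL := lobatto3_half H r r0 hr hH he).
    assert (r1 : r <= 1) by nra.
    rewrite (h1 r) in hG, hL by lra.
    (* At 0 this yields [f 0 + f 0], which restores the full weight of the central node. *)
    rewrite (h1 0), (h1 1), Ropp_0 in hL by lra.
    replace (- (1)) with (-1) in hL by ring. lra.
  - destruct (exists_antiderivs 4 f hC hconv) as [H [h0 [h1 [hH he]]]];
      [now exists 2%nat|].
    destruct (sqrt_ratio_sq 15 5) as [r0 hr]; [lra|lra|].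
    destruct (sqrt_ratio_sq 5 5) as [s0 hs]; [lra|lra|].
    unfold gauss, gauss3. simpl lobatto. unfold lobatto4.
    set (r := sqrt 15 / 5) in *. set (s := sqrt 5 / 5) in *.
    replace (15 / (5 * 5)) with (3 / 5) in hr by field.
    replace (5 / (5 * 5)) with (1 / 5) in hs by field.
    assert (hG := gauss3_half H r r0 hr hH he).
    assert (hL := lobatto4_half H r s r0 hr s0 hs hH he).
    assert (r1 : r <= 1) by nra. assert (s1 : s <= 1) by nra.
    rewrite (h1 r), (h1 0), Ropp_0 in hG by lra.
    rewrite (h1 1), (h1 r), (h1 s), (h1 0), Ropp_0 in hL by lra.
    replace (- (1)) with (-1) in hL by ring. lra.
Qed.
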